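(* Let $\mathcal N$ be a finite, locally irreducible, strongly connected and critical abelian network. A component $\mathcal C$ of the trajectory digraph of $\mathcal N$ is a recurrent component if and only if $\mathcal C$ contains a recurrent configuration.
   Context: Abelian networks. $\mathbb N=\{0,1,2,\dots\}$. Let $G=(V,E)$ be a finite directed graph (self-loops and multiple edges allowed). An abelian network $\mathcal N$ on $G$ assigns to each $v\in V$ a nonempty input alphabet $A_v$ and a nonempty state space $Q_v$ (the $A_v$ pairwise disjoint), maps $T_a:Q_v\to Q_v$ for $a\in A_v$, and, for each edge $e$ from $v$ to $u$, a message-passing function $T_e:Q_v\times A_v\to A_u^*$ (free monoid of words), such that for all $v$, $a,b\in A_v$, $q\in Q_v$: $T_aT_b=T_bT_a$, and for every edge $e$ out of $v$ the words $T_e(q,a)T_e(T_a(q),b)$ and $T_e(q,b)T_e(T_b(q),a)$ agree up to permuting letters. Put $A=\bigsqcup_v A_v$, $Q=\prod_v Q_v$; $\mathcal N$ is finite if $A$ and $Q$ are finite. For a word $w\in A^*$, $|w|\in\mathbb N^A$ counts the occurrences of each letter. For $a\in A_v$, $\mathbf q\in Q$: $t_a\mathbf q$ is $\mathbf q$ with $\mathbf q(v)$ replaced by $T_a(\mathbf q(v))$, and $\mathbf M_a(\mathbf q)=\sum_{e\text{ out of }v}|T_e(\mathbf q(v),a)|\in\mathbb N^A$. A configuration is a pair $\mathbf x.\mathbf q$ with $\mathbf x\in\mathbb Z^A$, $\mathbf q\in Q$; $\pi_a(\mathbf x.\mathbf q)=(\mathbf x+\mathbf M_a(\mathbf q)-|a|).t_a\mathbf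 q$. For $w=a_1\cdots a_\ell$: $t_w=t_{a_\ell}\cdots t_{a_1}$, $\mathbf M_w(\mathbf q)=\sum_i\mathbf M_{a_i}(t_{a_1\cdots a_{i-1}}\mathbf q)$, $\pi_w=\pi_{a_\ell}\cdots\pi_{a_1}$; these depend only on $|w|$, so $t_{\mathbf n},\mathbf M_{\mathbf n},\pi_{\mathbf n}$ are defined for $\mathbf n\in\mathbb N^A$. The word $w$ is legal for $\mathbf x.\mathbf q$ if, with $\mathbf x_i.\mathbf q_i=\pi_{a_1\cdots a_i}(\mathbf x.\mathbf q)$, $\mathbf x_{i-1}(a_i)\ge1$ for all $1\le i\le\ell$. Write $\mathbf x.\mathbf q\xrightarrow{w}\mathbf x'.\mathbf q'$ if $w$ is legal for $\mathbf x.\mathbf q$ and $\pi_w(\mathbf x.\mathbf q)=\mathbf x'.\mathbf q'$; write $\mathbf x.\mathbf q\to\mathbf x'.\mathbf q'$ if this holds for some (possibly empty) $w$. Local recurrence, kernel, production matrix. $\mathcal N$ is locally irreducible if for all $\mathbf q,\mathbf q'\in Q$ there are words $w,w'$ with $t_w\mathbf q=t_{w'}\mathbf q'$. For $\mathcal N$ finite, let $e$ be the product of all idempotents of the finite commutative monoid generated by the $t_a$ in $\mathrm{End}(Q)$; $\mathrm{Loc}(\mathcal N)=eQ$. The total kernel is $K=\{\mathbf z\in\mathbb Z^A: t_{\mathbf z^+}\mathbf q=t_{\mathbf z^-}\mathbf q\ \forall\mathbf q\in\mathrm{Loc}(\mathcal N)\}$, with $\mathbf z^{\pm}\in\mathbb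 N^A$ the positive/negative parts of $\mathbf z$. For $\mathcal N$ finite and locally irreducible, the production matrix $P$ is the unique rational $A\times A$ matrix with $P\mathbf k=\mathbf M_{\mathbf k}(\mathbf q)$ for all $\mathbf k\in K\cap\mathbb N^A$ and $\mathbf q\in\mathrm{Loc}(\mathcal N)$. $\mathcal N$ is critical if the spectral radius of $P$ is $1$, and strongly connected if the digraph on $A$ with an edge $(a,b)$ whenever $P_{ba}>0$ is strongly connected. Components and recurrence. Two configurations are legally related if there is $\mathbf x_3.\mathbf q_3$ with $\mathbf x_1.\mathbf q_1\to\mathbf x_3.\mathbf q_3$ and $\mathbf x_2.\mathbf q_2\to\mathbf x_3.\mathbf q_3$ (an equivalence relation). A component of the trajectory digraph (the digraph on configurations with an $a$-labelled edge whenever $\mathbf x.\mathbf q\xrightarrow{a}\mathbf x'.\mathbf q'$) is an equivalence class of this relation. An infinite walk is a sequence of configurations $\mathbf x_i.\mathbf q_i$ and letters $a_i$ with $\mathbf x_{i-1}.\mathbf q_{i-1}\xrightarrow{a_i}\mathbf x_i.\mathbf q_i$ for consecutive indices in $I$, where $I$ is $\mathbb Z_{\le0}$, $\mathbb Z_{\ge0}$ or $\mathbb Z$; it is diverse if each letter $a\in A$ equals $a_i$ for infinitely many $i$. A component is recurrent if it contains a diverse infinite walk. A configuration $\mathbf x.\mathbf q$ is recurrent if there is a nonempty legal execution for $\mathbf x.\mathbf q$, and every configuration $\mathbf x'.\mathbf q'$ legally related to $\mathbf x.\mathbf q$ satisfies $\mathbf x'.\mathbf q'\to\mathbf x.\mathbf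 q$. *)

(* Defs.v *)
From mathcomp Require Import all_boot all_order all_algebra all_field.
From mathcomp Require Import boolp classical_sets cardinality.

Set Implicit Arguments.
Unset Strict Implicit.
Unset Printing Implicit Defensive.

Import Order.TTheory GRing.Theory Num.Theory.
Local Open Scope ring_scope.

Record digraph := Digraph {
  vertex : finType;
  edge : finType;
  src : edge -> vertex;
  tgt : edge -> vertex }.

Record finite_abelian_network (G : digraph) := FiniteAbelianNetwork {
  alph : vertex G -> finType;
  state : vertex G -> finType;
  alph_nonempty : forall v, inhabited (alph v);
  state_nonempty : forall v, inhabited (state v);
  trans : forall v, alph v -> state v -> state v;
  message : forall e : edge G,
    state (src e) -> alph (src e) -> seq (alph (tgt e));
  trans_comm : forall v (a b : alph v) (q : state v),
    trans a (trans b q) = trans b (trans a q);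
  message_comm : forall (e : edge G) (a b : alph (src e)) (q : state (src e)),
    perm_eq (message q a ++ message (trans a q) b)
            (message q b ++ message (trans b q) a) }.

Definition is_spectral_radius (n : nat) (M : 'M[algC]_n) (r : algC) : Prop :=
  (exists2 l : algC, eigenvalue M l & `|l| = r) /\
  (forall l : algC, eigenvalue M l -> `|l| <= r).

Section Network.
Variables (G : digraph) (N : finite_abelian_network G).

(* A letter carries its vertex, which makes the alphabets disjoint. *)
Definition letter : finType := {v : vertex G & alph N v}.

Definition gstate : finType := {dffun forall v : vertex G, state N v}.

Definition config : Type := ({ffun letter -> int} * gstate)%type.

Definition act (a : letter) (q : gstate) : gstate :=
  finfun (dfwith q (trans (tagged a) (q (tag a)))).

(* The word sent along [e] when the letter [a] is processed; it is empty when
   [e] does not leave the vertex of [a]. *)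
Definition sent (e : edge G) (a : letter) (q : gstate) : seq letter :=
  untag [::] (fun b : alph N (src e) =>
    [seq Tagged (alph N) c | c <- message (q (src e)) b]) a.

Definition messages (a : letter) (q : gstate) : {ffun letter -> nat} :=
  [ffun c => (\sum_(e | src e == tag a) count_mem c (sent e a q))%N].

Definition fire (a : letter) (c : config) : config :=
  ([ffun b => c.1 b + (messages a c.2 b)%:Z - (b == a)%:Z], act a c.2).

Definition act_word (w : seq letter) (q : gstate) : gstate :=
  foldl (fun q a => act a q) q w.

Fixpoint messages_word (w : seq letter) (q : gstate) : {ffun letter -> nat} :=
  if w is a :: w' then
    [ffun c => (messages a q c + messages_word w' (act a q) c)%N]
  else [ffun=> 0%N].

Definition fire_word (w : seq letter) (c : config) : config :=
  foldl (fun c a => fire a c) c w.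

(* A word with letter counts [n]; [act_perm] and [messages_perm] below show
   that its choice is irrelevant. *)
Definition word_of (n : {ffun letter -> nat}) : seq letter :=
  flatten [seq nseq (n a) a | a <- enum letter].

Definition act_vec (n : {ffun letter -> nat}) : gstate -> gstate :=
  act_word (word_of n).

Definition messages_vec (n : {ffun letter -> nat}) :
  gstate -> {ffun letter -> nat} := messages_word (word_of n).

Lemma count_word_of (n : {ffun letter -> nat}) (a : letter) :
  count_mem a (word_of n) = n a.
Proof.
rewrite /word_of count_flatten -map_comp sumnE big_map big_enum /=.
rewrite (bigD1 a) //= count_nseq /= eqxx mul1n big1 ?addn0 // => b neq_ba.
by rewrite count_nseq /= (negPf neq_ba).
Qed.

Definition locally_irreducible : Prop :=
  forall q q' : gstate, exists w w' : seq letter, act_word w q = act_word w' q'.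

Definition endo : finType := {ffun gstate -> gstate}.

Definition endo_comp (f g : endo) : endo := [ffun q => f (g q)].

Definition endo_id : endo := [ffun q => q].

Definition in_trans_monoid (f : endo) : bool :=
  `[< exists w : seq letter, f = [ffun q => act_word w q] >].

(* The order of composition is irrelevant, as these endomorphisms commute. *)
Definition min_idempotent : endo :=
  \big[endo_comp/endo_id]_(f | in_trans_monoid f && (endo_comp f f == f)) f.

Definition locally_recurrent (q : gstate) : Prop :=
  exists q0 : gstate, q = min_idempotent q0.

Definition pos_part (z : {ffun letter -> int}) : {ffun letter -> nat} :=
  [ffun a => `|Num.max (z a) 0|%N].

Definition neg_part (z : {ffun letter -> int}) : {ffun letter -> nat} :=
  [ffun a => `|Num.max (- z a) 0|%N].

Definition total_kernel (z : {ffun letter -> int}) : Prop :=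
  forall q : gstate, locally_recurrent q ->
    act_vec (pos_part z) q = act_vec (neg_part z) q.

Definition col_of (n : {ffun letter -> nat}) : 'cV[rat]_#|letter| :=
  \col_i (n (enum_val i))%:R.

Definition is_production_matrix (P : 'M[rat]_#|letter|) : Prop :=
  forall k : {ffun letter -> nat}, total_kernel [ffun a => (k a)%:Z] ->
  forall q : gstate, locally_recurrent q ->
    P *m col_of k = col_of (messages_vec k q).

(* For a locally irreducible network there is exactly one such matrix. *)
Definition production_matrix : 'M[rat]_#|letter| :=
  xget 0 is_production_matrix.

Definition critical : Prop :=
  is_spectral_radius (map_mx (ratr : rat -> algC) production_matrix) 1.

Definition strongly_connected : Prop :=
  forall a b : letter,
    connect (fun c d => 0 < production_matrix (enum_rank d) (enum_rank c)) a b.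

Fixpoint legal (w : seq letter) (c : config) : bool :=
  if w is a :: w' then (1 <= c.1 a) && legal w' (fire a c) else true.

Definition exec (w : seq letter) (c c' : config) : Prop :=
  legal w c /\ fire_word w c = c'.

Definition reaches (c c' : config) : Prop :=
  exists w : seq letter, exec w c c'.

Definition legally_related (c1 c2 : config) : Prop :=
  exists c3 : config, reaches c1 c3 /\ reaches c2 c3.

Definition is_component (C : set config) : Prop :=
  exists c : config, C = [set c' | legally_related c c']%classic.

(* The walk has configurations [x i] for [i] in [I] and letters [a i] for
   [i - 1] and [i] both in [I]; values of [x] and [a] elsewhere are junk. *)
Definition infinite_walk
    (I : set int) (x : int -> config) (a : int -> letter) : Prop :=
  (I = [set i | i <= 0]%classic \/ I = [set i | 0 <= i]%classic \/
   I = [set: int]%classic) /\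
  forall i : int, I (i - 1) -> I i -> exec [:: a i] (x (i - 1)) (x i).

Definition diverse (I : set int) (a : int -> letter) : Prop :=
  forall b : letter, infinite_set [set i | I (i - 1) /\ I i /\ a i = b]%classic.

Definition recurrent_component (C : set config) : Prop :=
  exists (I : set int) (x : int -> config) (a : int -> letter),
    [/\ infinite_walk I x a, diverse I a & forall i : int, I i -> C (x i)].

Definition recurrent_config (c : config) : Prop :=
  (exists w : seq letter, w <> [::] /\ legal w c) /\
  forall c' : config, legally_related c c' -> reaches c' c.

Lemma actC (a b : letter) (q : gstate) : act a (act b q) = act b (act a q).
Proof.
case: a => v a; case: b => u b.
apply/ffunP => x; rewrite !ffunE /= .
have [euv|neq_uv] := eqVneq u v.
  subst u; rewrite !dfwith_in.
  have [<-|neq_vx] := eqVneq v x; first by rewrite !dfwith_in trans_comm.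
  by rewrite !dfwith_out // !ffunE !dfwith_out.
rewrite [dfwith q _ v]dfwith_out // [dfwith q _ u]dfwith_out 1?eq_sym //.
have [evx|neq_vx] := eqVneq v x.
  by subst x; rewrite dfwith_in dfwith_out // ffunE dfwith_in.
have [eux|neq_ux] := eqVneq u x.
  by subst x; rewrite dfwith_in dfwith_out // ffunE dfwith_in.
by rewrite !dfwith_out // !ffunE !dfwith_out.
Qed.

Lemma sent_perm (e : edge G) (a b : letter) (q : gstate) :
  perm_eq (sent e a q ++ sent e b (act a q)) (sent e b q ++ sent e a (act b q)).
Proof.
case: a => v a; case: b => u b; rewrite /sent.
have [ev|neq_v] := eqVneq v (src e); last first.
  rewrite !(@untag_dflt _ _ _ _ _ _ (existT _ v a)) //= cats0.
  by rewrite !ffunE dfwith_out // perm_refl.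
have [eu|neq_u] := eqVneq u (src e); last first.
  rewrite !(@untag_dflt _ _ _ _ _ _ (existT _ u b)) //= cats0.
  by rewrite !ffunE dfwith_out // perm_refl.
subst v u.
have E : forall (F : alph N (src e) -> seq letter) x,
    untag [::] F (Tagged (alph N) x) = F x.
  move=> F x.
  exact: (@untagE _ (fun v => alph N v) _ [::] _ F (Tagged (alph N) x) erefl).
rewrite !E !ffunE /= !dfwith_in.
by rewrite -!map_cat perm_map // message_comm.
Qed.

Lemma messagesC (a b c : letter) (q : gstate) :
  (messages a q c + messages b (act a q) c =
   messages b q c + messages a (act b q) c)%N.
Proof.
rewrite !ffunE.
have E (x y : letter) p : (\sum_(e | src e == tag x) count_mem y (sent e x p) =
    \sum_e count_mem y (sent e x p))%N.
  rewrite [RHS](bigID (fun e => src e == tag x)) /= [X in (_ + X)%N]big1 ?addn0 //.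
  by move=> e ne; rewrite /sent untag_dflt // eq_sym.
rewrite !E -!big_split /=; apply: eq_bigr => e _.
by rewrite -!count_cat; apply/permP; exact: sent_perm.
Qed.

Lemma act_move (a : letter) (s t : seq letter) (q : gstate) :
  act_word (s ++ a :: t) q = act_word (a :: s ++ t) q.
Proof.
elim: s q => [//|b s IHs] q; rewrite cat_cons [LHS]IHs /=.
by rewrite /act_word /= actC.
Qed.

Lemma messages_cons (a : letter) (w : seq letter) (q : gstate) (c : letter) :
  messages_word (a :: w) q c = (messages a q c + messages_word w (act a q) c)%N.
Proof. by rewrite ffunE. Qed.

Lemma messages_move (a : letter) (s t : seq letter) (q : gstate) :
  messages_word (s ++ a :: t) q = messages_word (a :: s ++ t) q.
Proof.
elim: s q => [//|b s IHs] q; apply/ffunP => c.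
rewrite cat_cons messages_cons IHs cat_cons !messages_cons.
by rewrite addnA messagesC -addnA actC.
Qed.

Lemma act_perm (w1 w2 : seq letter) (q : gstate) :
  perm_eq w1 w2 -> act_word w1 q = act_word w2 q.
Proof.
elim: w1 w2 q => [|a w1 IHw] w2 q; first by rewrite perm_sym => /perm_nilP ->.
move=> w12; have aw2 : a \in w2 by rewrite -(perm_mem w12) mem_head.
move: w12; case/splitPr: w2 / aw2 => s t w12.
rewrite act_move; apply: IHw.
by rewrite -(perm_cons a) (perm_trans w12) // -[a :: t]cat1s perm_catCA.
Qed.

Lemma messages_perm (w1 w2 : seq letter) (q : gstate) :
  perm_eq w1 w2 -> messages_word w1 q = messages_word w2 q.
Proof.
elim: w1 w2 q => [|a w1 IHw] w2 q; first by rewrite perm_sym => /perm_nilP ->.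
move=> w12; have aw2 : a \in w2 by rewrite -(perm_mem w12) mem_head.
move: w12; case/splitPr: w2 / aw2 => s t w12.
rewrite messages_move; apply/ffunP => c; rewrite !messages_cons.
rewrite (IHw (s ++ t)) //.
by rewrite -(perm_cons a) (perm_trans w12) // -[a :: t]cat1s perm_catCA.
Qed.

End Network.

(* Main.v *)
Require Import Defs.
From mathcomp Require Import all_boot all_order all_algebra all_field.
From mathcomp Require Import boolp classical_sets cardinality.
From mathcomp Require Import ring zify.

(* If a word [v] returns to the local state [q], then by local irreducibility
   its letter counts lie in the total kernel, so [P |v|] is the vector of
   messages that [v] sends from [q]. Two consequences: a nonempty legal cycle
   of configurations satisfies [P |v| = |v|], hence uses every letter since [P]
   is irreducible; and, for a positive left Perron vector [s] of [P], the level
   [s x] of a configuration [x.q] changes by a bounded amount along every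
   execution, since cutting a cycle out of a word does not change the drift.

   On a diverse walk every letter count is nonnegative once the letter has
   fired, so some arbitrarily long segments stay in a finite set of
   configurations and contain a cycle. A legal cycle through all the letters
   absorbs every legal execution, by the removal lemma, so its configurations
   are recurrent. Conversely a recurrent configuration lies on a nonempty legal
   cycle, and repeating this cycle is a diverse walk. *)

Set Implicit Arguments.
Unset Strict Implicit.
Unset Printing Implicit Defensive.

Import Order.TTheory GRing.Theory Num.Theory.
Local Open Scope ring_scope.

(** * Perron vectors of irreducible matrices *)

Lemma expr_unbounded (r K : algC) : 1 < r -> 0 <= K -> exists k, K < r ^+ k.
Proof.
move=> r_gt1 K_ge0; have d_gt0 : 0 < r - 1 by rewrite subr_gt0.
have bernoulli k : 1 + (r - 1) *+ k <= r ^+ k.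
  elim: k => [|k IHk]; first by rewrite mulr0n addr0.
  rewrite exprS mulrS addrCA.
  have -> : r * r ^+ k = (r - 1) * r ^+ k + r ^+ k by ring.
  apply: lerD => //; apply: ler_peMr; first exact: ltW.
  by apply: exprn_ege1; exact: ltW.
exists (Num.bound (K / (r - 1))).
apply: lt_le_trans (bernoulli _).
have /archi_boundP := divr_ge0 K_ge0 (ltW d_gt0).
rewrite ltr_pdivrMr // mulr_natl => /lt_trans; apply.
by rewrite ltrDr.
Qed.

Section Perron.
Variables (n : nat) (A : 'M[algC]_n).

(** The factors are peeled off one at a time: [v A^(k+1)] is [l] times [v A^k] plus
    [(v (A - l)) A^k]. The first term does not grow since [|l| <= 1], and induction controls the
    second. *)
Lemma iter_mulmx_bound (mu : algC) (rs : seq algC) (v : 'rV[algC]_n) :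
    1 < mu -> (forall l, l \in rs -> `|l| <= 1) ->
    foldl (fun u l => u *m (A - l%:M)) v rs = 0 ->
  exists2 K : algC, 0 <= K &
    forall k j, `|iter k (mulmxr A) v 0 j| <= K * mu ^+ k.
Proof.
move=> mu_gt1; have mu_ge0 : 0 <= mu by rewrite (le_trans ler01) ?ltW.
elim: rs v => [|l rs IH] v /= rs_le1 => [-> | killed].
  exists 0 => // k j; rewrite mul0r.
  suff -> : iter k (mulmxr A) (0 : 'rV[algC]_n) = 0 by rewrite mxE normr0.
  by elim: k => //= k ->; rewrite mul0mx.
have [l' l'rs|K K_ge0 IHK] := IH _ _ killed.
  by apply: rs_le1; rewrite inE l'rs orbT.
have V_ge0 : 0 <= \sum_i `|v 0 i| by apply: sumr_ge0.
have mu1 : 0 < mu - 1 by rewrite subr_gt0.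
have K1_ge0 : 0 <= K / (mu - 1) by rewrite divr_ge0 // ltW.
(* The sum starts the induction; [K1 = K / (mu - 1)] solves [K1 * mu = K1 + K] and so absorbs the
   increments [K * mu ^+ k]. *)
exists (\sum_i `|v 0 i| + K / (mu - 1)); first exact: addr_ge0.
have iterD k : iter k.+1 (mulmxr A) v =
    l *: iter k (mulmxr A) v + iter k (mulmxr A) (v *m (A - l%:M)).
  elim: k => [|k IHk] /=; first by rewrite mulmxBr mul_mx_scalar addrC subrK.
  by rewrite /= in IHk; rewrite {1}IHk mulmxDl scalemxAl.
elim=> [|k IHk] j.
  rewrite expr0 mulr1 /= (bigD1 j) //= -addrA lerDl.
  by rewrite addr_ge0 // sumr_ge0.
rewrite iterD !mxE (le_trans (ler_normD _ _)) // normrM.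
have /(_ l (mem_head _ _)) l_le1 := rs_le1.
apply: (le_trans (lerD (ler_piMl (normr_ge0 _) l_le1) (IHK k j))).
apply: (le_trans (lerD (IHk j) (lexx _))).
set V := \sum_i _ in V_ge0 *; set K1 := K / _ in K1_ge0 *.
have -> : K = K1 * (mu - 1) by rewrite divfK ?gt_eqF.
have mu1_ge0 := ltW mu1.
rewrite -subr_ge0 exprS; set m := mu ^+ k.
have -> : (V + K1) * (mu * m) - ((V + K1) * m + K1 * (mu - 1) * m) =
  V * (mu - 1) * m by ring.
by rewrite !mulr_ge0 ?exprn_ge0.
Qed.

Lemma Cayley_Hamilton_factors :
  exists2 rs : seq algC, (forall l, l \in rs -> eigenvalue A l) &
    forall v : 'rV_n, foldl (fun u l => u *m (A - l%:M)) v rs = 0.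
Proof.
case: n A => [|m] B.
  by exists [::] => // v; apply/rowP; case.
have [rs char_rs] := closed_field_poly_normal (char_poly B).
rewrite (monicP (char_poly_monic B)) scale1r in char_rs.
exists rs => [l lrs|v].
  by rewrite eigenvalue_root_char char_rs root_prod_XsubC.
have foldE (s : seq algC) (u : 'rV_m.+1) :
    foldl (fun u l => u *m (B - l%:M)) u s
    = u *m horner_mx B (\prod_(l <- s) ('X - l%:P)).
  elim: s u => [|l s IHs] u /=; first by rewrite big_nil rmorph1 mulmx1.
  rewrite IHs big_cons rmorphM /= -mulmxA rmorphB /= horner_mx_X horner_mx_C.
  by [].
by rewrite foldE -char_rs Cayley_Hamilton mulmx0.
Qed.


Hypothesis A_ge0 : forall i j, 0 <= A i j.

Lemma iter_mulmx_growth (r : algC) (z : 'rV[algC]_n) :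
    0 <= r -> (forall j, r * z 0 j <= (z *m A) 0 j) ->
  forall k j, r ^+ k * z 0 j <= iter k (mulmxr A) z 0 j.
Proof.
move=> r_ge0 zA; elim=> [|k IHk] j; first by rewrite expr0 mul1r.
rewrite iterS [mulmxr A _]/mulmxr mxE exprSr -mulrA.
apply: (le_trans (ler_wpM2l (exprn_ge0 k r_ge0) (zA j))).
by rewrite mxE mulr_sumr ler_sum // => i _; rewrite mulrA ler_wpM2r.
Qed.

(** With finitely many coordinates the growth is uniform, so the iterates of [z] grow at least like
    [(1 + 2 eps)^k]; the spectral bound caps them by a multiple of [(1 + eps)^k]. *)
Lemma no_strict_growth (z : 'rV[algC]_n) :
    (forall l, eigenvalue A l -> `|l| <= 1) -> (0 < n)%N ->
    (forall j, 0 < z 0 j) -> ~ (forall j, z 0 j < (z *m A) 0 j).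
Proof.
move=> spec n_gt0 z_gt0 zA.
pose d j := (z *m A) 0 j - z 0 j.
have d_gt0 j : 0 < d j by rewrite subr_gt0.
pose j0 : 'I_n := Ordinal n_gt0.
pose S := \sum_j z 0 j / d j.
have S_ge j : z 0 j / d j <= S.
  rewrite /S (bigD1 j) //= lerDl sumr_ge0 // => i _.
  by rewrite divr_ge0 ?ltW.
have S_gt0 : 0 < S by rewrite (lt_le_trans _ (S_ge j0)) // divr_gt0.
(* As [S] dominates each [z 0 j / d j], the gap [d j] is at least [z 0 j / S = 2 * eps * z 0 j]. *)
pose eps := (2 * S)^-1.
have eps_gt0 : 0 < eps by rewrite invr_gt0 mulr_gt0.
have eps1 : 1 < 1 + eps by rewrite ltrDl.
have growth j : (1 + eps + eps) * z 0 j <= (z *m A) 0 j.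
  have -> : 1 + eps + eps = 1 + S^-1.
    by rewrite /eps invfM -addrA -mulrDl -[2^-1]mul1r -splitr mul1r.
  rewrite mulrDl mul1r -lerBrDl mulrC ler_pdivrMr // -/(d j).
  by rewrite -ler_pdivrMl // mulrC.
have r_ge0 : 0 <= 1 + eps + eps by rewrite !addr_ge0 ?ltW.
have [rs rsP rsK] := Cayley_Hamilton_factors.
have [|K K_ge0 KP] := iter_mulmx_bound eps1 _ (rsK z).
  by move=> l /rsP /spec.
have e_gt0 : 0 < 1 + eps by rewrite addr_gt0.
have [||k] := @expr_unbounded ((1 + eps + eps) / (1 + eps)) (K / z 0 j0).
- by rewrite ltr_pdivlMr // mul1r ltrDl.
- by apply: divr_ge0 => //; exact: ltW.
apply/negP; rewrite -real_leNgt; last 2 first.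
- by apply: ger0_real; rewrite exprn_ge0 // divr_ge0 // ltW.
- by apply: ger0_real; apply: divr_ge0 => //; exact: ltW.
rewrite ler_pdivlMr // exprMn exprVn mulrAC ler_pdivrMr ?exprn_gt0 //.
have zk := iter_mulmx_growth r_ge0 growth k j0.
apply: (le_trans zk); rewrite -[leLHS]ger0_norm ?KP //.
by rewrite (le_trans _ zk) // mulr_ge0 ?exprn_ge0 // ltW.
Qed.

Hypothesis A_irr : forall i j : 'I_n, connect (fun c d => 0 < A d c) i j.

Lemma mulmx_ge0 (v : 'rV[algC]_n) :
  (forall j, 0 <= v 0 j) -> forall j, 0 <= (v *m A) 0 j.
Proof. by move=> v_ge0 j; rewrite mxE sumr_ge0 // => i _; rewrite mulr_ge0. Qed.

Lemma mulmx_gt0 (v : 'rV[algC]_n) i j :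
  (forall j, 0 <= v 0 j) -> 0 < v 0 i -> 0 < A i j -> 0 < (v *m A) 0 j.
Proof.
move=> v_ge0 vi Aij; rewrite mxE (bigD1 i) //= ltr_pwDl ?mulr_gt0 //.
by rewrite sumr_ge0 // => k _; rewrite mulr_ge0.
Qed.

(** Row vectors carry positivity backwards along the edges of [A_irr]: an edge from [c] to [d] means
    [A d c > 0], so a positive entry at [d] gives one at [c]. *)
Lemma fixed_gt0 (v : 'rV[algC]_n) :
  (forall j, 0 <= v 0 j) -> v != 0 -> v *m A = v -> forall j, 0 < v 0 j.
Proof.
move=> v_ge0 v_neq0 vA j.
have [i vi] : exists i, 0 < v 0 i.
  have /rV0Pn[i vi] := v_neq0; exists i.
  by rewrite lt0r v_ge0 vi.
have /connectP[p] := A_irr j i.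
elim: p j => [|k p IHp] j /=; first by move=> _ <-.
move=> /andP[Akj kp] lastp; rewrite -vA.
exact: mulmx_gt0 v_ge0 (IHp k kp lastp) Akj.
Qed.

(** Adding the identity keeps positive entries positive, so one exponent serves all coordinates even
    when [A] is periodic. *)
Let step (v : 'rV[algC]_n) := v *m (1%:M + A).

Lemma iter_step_gt0 (d : 'rV[algC]_n) :
  (forall j, 0 <= d 0 j) -> d != 0 ->
  exists m, forall j, 0 < iter m step d 0 j.
Proof.
move=> d_ge0 d_neq0.
have stepE v : step v = v + v *m A by rewrite /step mulmxDr mulmx1.
have iter_ge0 m j : 0 <= iter m step d 0 j.
  elim: m j => [|m IHm] j //=.
  by rewrite stepE mxE addr_ge0 ?mulmx_ge0.
have iter_mono m p j : (m <= p)%N -> 0 < iter m step d 0 j ->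
    0 < iter p step d 0 j.
  move=> /subnK <-; elim: (p - m)%N => [|k IHk] //= /IHk itk.
  by rewrite stepE mxE ltr_pwDl ?mulmx_ge0.
have [i di] : exists i, 0 < d 0 i.
  have /rV0Pn[i di] := d_neq0; exists i.
  by rewrite lt0r d_ge0 di.
have reach j : exists m, 0 < iter m step d 0 j.
  have /connectP[p] := A_irr j i.
  elim: p j => [|k p IHp] j /=; first by move=> _ <-; exists 0%N.
  move=> /andP[Akj kp] lastp.
  have [m mk] := IHp k kp lastp; exists m.+1.
  by rewrite /= stepE mxE ltr_wpDl ?(mulmx_gt0 _ mk).
pose m j := projT1 (cid (reach j)).
exists (\max_j m j)%N => j; apply: (iter_mono (m j)); first exact: leq_bigmax.
by rewrite /m; case: cid.
Qed.

(* If [y A <> y] for [y := |v|], with [v] an eigenvector of modulus 1, then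
   [y A - y >= 0] is nonzero and an iterate [z] of [y] under [1 + A] satisfies
   [z A > z] strictly, which the spectral radius excludes. *)
Lemma Perron_vector : is_spectral_radius A 1 ->
  exists2 s : 'rV[algC]_n, (forall j, 0 < s 0 j) & s *m A = s.
Proof.
move=> [[l /eigenvalueP[v vA v_neq0] l_norm1] spec].
pose y : 'rV[algC]_n := \row_j `|v 0 j|.
have y_ge0 j : 0 <= y 0 j by rewrite mxE.
have y_neq0 : y != 0.
  have /rV0Pn[i vi] := v_neq0; apply/rV0Pn; exists i.
  by rewrite mxE normr_eq0.
have yA j : y 0 j <= (y *m A) 0 j.
  rewrite !mxE -[leLHS]mul1r -l_norm1 -normrM.
  have -> : l * v 0 j = (v *m A) 0 j by rewrite vA mxE.
  rewrite mxE (le_trans (ler_norm_sum _ _ _)) // ler_sum // => i _.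
  by rewrite mxE normrM (ger0_norm (A_ge0 _ _)).
have [yAy|yAy] := eqVneq (y *m A) y.
  by exists y => //; apply: fixed_gt0.
have [||m mP] := @iter_step_gt0 (y *m A - y).
- by move=> j; rewrite [leRHS]mxE [(- y) _ _]mxE subr_ge0 yA.
- by rewrite subr_eq0.
have n_gt0 : (0 < n)%N.
  by have /rV0Pn[i _] := v_neq0; apply: leq_trans (ltn_ord i).
(* The exponent [m] makes the gap [y A - y] positive and [m'] makes [y] itself positive; by [iterP]
   the sum of the two does both. *)
have [||m' m'P] := @iter_step_gt0 y => //.
have iterB k (u : 'rV_n) : 
      iter k step (u *m A - u) = iter k step u *m A - iter k step u.
  elim: k => //= k ->; rewrite /step mulmxBl -!mulmxA.
  by congr (_ *m _ - _); rewrite mulmxDl mulmxDr mul1mx mulmx1.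
have iterP k (u : 'rV_n) :
    (forall j, 0 < u 0 j) -> forall j, 0 < iter k step u 0 j.
  move=> u_gt0; elim: k => //= k IHk j.
  rewrite /step mulmxDr mulmx1 mxE ltr_pwDl ?mulmx_ge0 // => i.
  exact: ltW.
case: (@no_strict_growth (iter (m' + m) step y)) => // j.
  by rewrite addnC iterD; apply: iterP.
rewrite -subr_gt0.
have -> : forall (a b : 'rV[algC]_n) , a 0 j - b 0 j = (a - b) 0 j.
  by move=> a b; rewrite !mxE.
by rewrite -iterB iterD; apply: iterP.
Qed.

End Perron.

(** * Executions and the removal lemma *)

Section Network.
Variables (G : digraph) (N : finite_abelian_network G).
Local Notation letter := (letter N).
Implicit Types (a b : letter) (w u v : seq letter).
Implicit Types (q : gstate N) (c d : config N).

Lemma act_cat w u q : act_word (w ++ u) q = act_word u (act_word w q).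
Proof. exact: foldl_cat. Qed.

Lemma act_wordC w u q :
  act_word w (act_word u q) = act_word u (act_word w q).
Proof. by rewrite -!act_cat; apply: act_perm; rewrite perm_catC. Qed.

Lemma messages_cat w u q b : messages_word (w ++ u) q b =
  (messages_word w q b + messages_word u (act_word w q) b)%N.
Proof.
elim: w q => [|a w IHw] q; first by rewrite ffunE.
by rewrite cat_cons !messages_cons IHw addnA.
Qed.

Lemma fire_wordE w c : fire_word w c =
  ([ffun b => c.1 b + (messages_word w c.2 b)%:Z - (count_mem b w)%:Z],
   act_word w c.2).
Proof.
elim: w c => [|a w IHw] [x q] /=.
  by congr pair; apply/ffunP => b; rewrite !ffunE addr0 subr0.
rewrite [LHS]IHw /=; congr pair; apply/ffunP => b.
rewrite !ffunE /= -!/(messages _ _) !PoszD eq_sym; ring.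
Qed.

Lemma fire_word_perm w u c : perm_eq w u -> fire_word w c = fire_word u c.
Proof.
move=> wu; rewrite !fire_wordE (act_perm _ wu) (messages_perm _ wu).
by congr pair; apply/ffunP => b; rewrite !ffunE (permP wu).
Qed.

Lemma fireC a b c : fire a (fire b c) = fire b (fire a c).
Proof.
apply: (@fire_word_perm [:: b; a] [:: a; b]).
exact/permPl/(perm_catC [:: b] [:: a]).
Qed.

Lemma fire_word_cat w u c : fire_word (w ++ u) c = fire_word u (fire_word w c).
Proof. exact: foldl_cat. Qed.

Lemma legal_cat w u c :
  legal (w ++ u) c = legal w c && legal u (fire_word w c).
Proof. by elim: w c => //= a w IHw c; rewrite IHw andbA. Qed.

Lemma exec_cat w u c d e : exec w c d -> exec u d e -> exec (w ++ u) c e.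
Proof.
by move=> [lw <-] [lu <-]; split; rewrite ?legal_cat ?fire_word_cat ?lw.
Qed.

Lemma exec_iter k v c : exec v c c -> exec (flatten (nseq k v)) c c.
Proof. by move=> vc; elim: k => [|k IHk] //=; apply: exec_cat IHk. Qed.

Lemma reaches_refl c : reaches c c.
Proof. by exists [::]. Qed.

Lemma reaches_trans c d e : reaches c d -> reaches d e -> reaches c e.
Proof. by move=> [w cd] [u de]; exists (w ++ u); apply: exec_cat de. Qed.

Lemma fire_other_ge a b c : b != a -> c.1 b <= (fire a c).1 b.
Proof. by move=> /negPf ba; rewrite ffunE ba subr0 lerDl. Qed.

(** Firing [a] in advance only raises the other coordinates, and commutes with the letters of [u] up
    to its first [a], where the two runs merge. *)
Lemma legal_rem a u c : legal u c -> 1 <= c.1 a -> legal (rem a u) (fire a c).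
Proof.
elim: u c => //= b u IHu c /andP[cb lu] ca.
have [<-//|ab] := eqVneq b a.
rewrite /= (le_trans cb (fire_other_ge _ ab)) fireC IHu //.
by rewrite (le_trans ca) // fire_other_ge // eq_sym.
Qed.

Definition residual u w : seq letter := foldl (fun u a => rem a u) u w.

Lemma legal_residual u w c :
  legal u c -> legal w c -> legal (residual u w) (fire_word w c).
Proof.
elim: w u c => //= a w IHw u c lu /andP[ca lw].
by apply: IHw => //; apply: legal_rem.
Qed.

Lemma count_residual u w b :
  count_mem b (residual u w) = (count_mem b u - count_mem b w)%N.
Proof.
elim: w u => [|a w IHw] u /=; first by rewrite subn0.
by rewrite IHw count_mem_rem subnDA.
Qed.

Lemma perm_eq_count w u :
  (forall b, count_mem b w = count_mem b u) -> perm_eq w u.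
Proof. by move=> wu; apply/allP => b _ /=; rewrite wu. Qed.

(** Each of [w] and [u] is completed by what the other has in excess. Both completions have letter
    counts [max(|w|, |u|)], hence the same endpoint. *)
Lemma confluence c d e : reaches c d -> reaches c e -> legally_related d e.
Proof.
move=> [w [lw <-]] [u [lu <-]]; exists (fire_word (w ++ residual u w) c).
split; [exists (residual u w) | exists (residual w u)]; split.
- exact: legal_residual.
- by rewrite fire_word_cat.
- exact: legal_residual.
rewrite -fire_word_cat; apply: fire_word_perm; apply: perm_eq_count => b.
by rewrite !count_cat !count_residual -!maxnE maxnC.
Qed.

(** If [w] leads from [c] to a common successor [d], enough turns of the cycle dominate [w] letter
    by letter, and the removal lemma turns the excess into an execution from [d] back to [c]. *)
Lemma cycle_recurrent v c :
  v != [::] -> (forall a, a \in v) -> exec v c c -> recurrent_config c.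
Proof.
move=> v_neq0 v_full vc; split; first by exists v; case: vc; move/eqP: v_neq0.
move=> c' [d [[w [lw cd]] c'd]]; apply: reaches_trans c'd _.
(* [size w] turns suffice because each turn uses every letter. *)
have [lu cu] := exec_iter (size w) vc; set u := flatten _ in lu cu.
exists (residual u w); split; first by rewrite -cd legal_residual.
rewrite -cd -fire_word_cat -[RHS]cu; apply: fire_word_perm.
apply: perm_eq_count => b; rewrite count_cat count_residual -maxnE.
apply/maxn_idPr; rewrite count_flatten map_nseq sumn_nseq.
apply: (leq_trans (count_size _ _)).
by rewrite leq_pmull // -has_count has_pred1.
Qed.

(** * The minimal idempotent of the transition monoid *)

Definition endo_of w : endo N := [ffun q => act_word w q].

Lemma in_trans_monoidP f :
  reflect (exists w, f = endo_of w) (in_trans_monoid f).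
Proof. exact: asboolP. Qed.

Lemma min_idempotent_word : exists u, min_idempotent N = endo_of u.
Proof.
apply: (big_ind (fun f => exists u, f = endo_of u)).
- by exists [::]; apply/ffunP => q; rewrite !ffunE.
- move=> _ _ [w ->] [u ->]; exists (u ++ w).
  by apply/ffunP => q; rewrite !ffunE act_cat.
- by move=> f /andP[/in_trans_monoidP].
Qed.

(** The idempotent of [w] is a factor of [min_idempotent N]; by commutativity it moves to that
    factor and is absorbed there. *)
Lemma min_idempotent_absorb w q :
    (forall q, act_word w (act_word w q) = act_word w q) ->
  act_word w (min_idempotent N q) = min_idempotent N q.
Proof.
move=> ww; pose P f := in_trans_monoid f && (endo_comp f f == f :> endo N).
have Pw : P (endo_of w).
  apply/andP; split; first by apply/in_trans_monoidP; exists w.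
  by apply/eqP/ffunP => p; rewrite !ffunE ww.
rewrite /min_idempotent.
have : endo_of w \in index_enum (endo N) by rewrite mem_index_enum.
elim: (index_enum _) => // g r IHr; rewrite inE big_cons -/(P g) => wr.
have [|Pg] := boolP (P g); last first.
  by case/orP: wr Pg => [/eqP <-|wr _]; [rewrite Pw | exact: IHr].
case/andP => /in_trans_monoidP[u gE] _; case/orP: wr => [/eqP <-|wr].
  by rewrite !ffunE ww.
by rewrite gE !ffunE act_wordC IHr.
Qed.

End Network.

(** * Local recurrence and the production matrix *)

Lemma ord_pigeonhole (T : finType) n (F : 'I_n -> T) :
  (#|T| < n)%N -> exists i : 'I_n, exists2 j : 'I_n, (i < j)%N & F i = F j.
Proof.
move=> lt_Tn; have : ~~ injectiveb F.
  by apply/injectiveP => /leq_card; rewrite card_ord leqNgt lt_Tn.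
move=> /injectivePn[i [j ij Fij]].
by move: ij; rewrite -val_eqE neq_ltn => /orP[]; [exists i, j | exists j, i].
Qed.

Lemma iter_idempotent (T : finType) (f : T -> T) :
  exists2 m, (0 < m)%N & forall x, iter m f (iter m f x) = iter m f x.
Proof.
pose F (i : 'I_#|{ffun T -> T}|.+1) : {ffun T -> T} := [ffun x => iter i f x].
have [|i [j lt_ij Fij]] := ord_pigeonhole F; first by rewrite ltnSn.
have itij x : iter i f x = iter j f x.
  by have /ffunP/(_ x) := Fij; rewrite !ffunE.
have shift k x : (i <= k)%N -> iter (k + (j - i)) f x = iter k f x.
  move=> le_ik; rewrite -{2}(subnK le_ik) [RHS]iterD itij -iterD.
  by congr iter; lia.
have shifts n k x : (i <= k)%N -> iter (k + n * (j - i)) f x = iter k f x.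
  move=> le_ik; elim: n => [|n IHn]; first by rewrite addn0.
  by rewrite mulSn addnCA addnC shift // (leq_trans le_ik) ?leq_addr.
have d_gt0 : (0 < j - i)%N by rewrite subn_gt0.
(* A positive multiple of the period [j - i] that is at least the preperiod [i]. *)
exists (j * (j - i))%N => [|x].
  by rewrite muln_gt0 d_gt0 (leq_ltn_trans _ lt_ij).
by rewrite -iterD shifts // (leq_trans (ltnW lt_ij)) ?leq_pmulr.
Qed.

Section LocalRecurrence.
Variables (G : digraph) (N : finite_abelian_network G).
Local Notation letter := (letter N).
Implicit Types (a b : letter) (w u v : seq letter).
Implicit Types (q : gstate N) (c d : config N).

Lemma act_word_nseq k a q : act_word (nseq k a) q = iter k (act a) q.
Proof. by elim: k q => //= k IHk q; rewrite [LHS]IHk -iterS iterSr. Qed.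

(** An idempotent power of [act a] is the identity on locally recurrent states, so each letter
    permutes them. *)
Lemma act_period a : exists2 m, (0 < m)%N &
  forall q, locally_recurrent q -> act_word (nseq m a) q = q.
Proof.
have [m m_gt0 mP] := iter_idempotent (@act _ N a).
exists m => // _ [q ->]; apply: min_idempotent_absorb => p.
by rewrite !act_word_nseq mP.
Qed.

Lemma locally_recurrent_act w q :
  locally_recurrent q -> locally_recurrent (act_word w q).
Proof.
move=> [p ->]; exists (act_word w p).
by have [u ->] := min_idempotent_word N; rewrite !ffunE act_wordC.
Qed.

Lemma act_word_inj w p q : locally_recurrent p -> locally_recurrent q ->
  act_word w p = act_word w q -> p = q.
Proof.
elim: w p q => //= a w IHw p q lp lq /IHw eq_a.
have {}eq_a : act a p = act a q.
  by apply: eq_a; apply: (@locally_recurrent_act [:: a]).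
have [[|m] // _ mP] := act_period a.
by rewrite -(mP p lp) -(mP q lq) /= eq_a.
Qed.

Hypothesis hirr : locally_irreducible N.

(** Irreducibility joins [q] and [p] in one state, which [v] fixes because it fixes [q]; the word
    from [p] to that state then cancels, as words are injective on locally recurrent states. *)
Lemma cycle_fixes_locally_recurrent v q p :
  act_word v q = q -> locally_recurrent p -> act_word v p = p.
Proof.
move=> vq lp; have [w [w' ww']] := hirr q p.
apply: (@act_word_inj w') => //; first exact: locally_recurrent_act.
by rewrite act_wordC -ww' act_wordC vq.
Qed.

Definition count_vec v : {ffun letter -> nat} := [ffun a => count_mem a v].

Lemma word_of_count v : perm_eq (word_of (count_vec v)) v.
Proof. by apply: perm_eq_count => b; rewrite count_word_of ffunE. Qed.

Lemma count_vec_kernel v :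
    (forall q, locally_recurrent q -> act_word v q = q) ->
  total_kernel [ffun a => (count_vec v a)%:Z].
Proof.
move=> vP q lq.
have -> : pos_part [ffun a => (count_vec v a)%:Z] = count_vec v.
  by apply/ffunP => a; rewrite !ffunE; lia.
have -> : neg_part [ffun a => (count_vec v a)%:Z] = count_vec [::].
  by apply/ffunP => a; rewrite !ffunE /=; lia.
by rewrite /act_vec !(act_perm _ (word_of_count _)) vP.
Qed.

Hypothesis hprod : is_production_matrix (production_matrix N).

Definition production b a : rat :=
  production_matrix N (enum_rank b) (enum_rank a).

Lemma production_loc v q b : locally_recurrent q ->
    (forall p, locally_recurrent p -> act_word v p = p) ->
  \sum_a production b a * (count_mem a v)%:R = (messages_word v q b)%:R.
Proof.
move=> lq vP.
have /matrixP/(_ (enum_rank b) 0) := hprod (count_vec_kernel vP) lq.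
rewrite !mxE enum_rankK /messages_vec (messages_perm _ (word_of_count v)) => <-.
rewrite [RHS](reindex enum_rank) /=; last exact/onW_bij/enum_rank_bij.
by apply: eq_bigr => a _; rewrite !mxE enum_rankK ffunE.
Qed.

(** A power [a^m] fixing all locally recurrent states isolates column [a]: [m] times the entry is a
    number of messages. The state [q] supplies a locally recurrent one. *)
Lemma production_ge0 q b a : 0 <= production b a.
Proof.
have [m m_gt0 mP] := act_period a.
have lq : locally_recurrent (min_idempotent N q) by exists q.
have := production_loc b lq mP.
rewrite (bigD1 a) //= big1 ?addr0 => [|c /negPf ca]; last first.
  by rewrite count_nseq /= eq_sym ca mulr0.
rewrite count_nseq /= eqxx mul1n => Pm.
have m0 : 0 < m%:R :> rat by rewrite ltr0n.
by rewrite -(pmulr_lge0 _ m0) Pm ler0n.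
Qed.

(** Here [q] may fail to be locally recurrent. A word [u] moves it to a locally recurrent state, and
    comparing the messages of [u v] and [v u] shows that [v] sends the same from both states. *)
Lemma production_cycle v q b : act_word v q = q ->
  \sum_a production b a * (count_mem a v)%:R = (messages_word v q b)%:R.
Proof.
move=> vq; have [u uE] := min_idempotent_word N.
have lq : locally_recurrent (act_word u q).
  by exists q; rewrite uE ffunE.
rewrite (production_loc b lq); last first.
  by move=> p; apply: cycle_fixes_locally_recurrent vq.
congr _%:R; apply/eqP; rewrite -(eqn_add2l (messages_word u q b)).
have /permPl uv := perm_catC u v.
by rewrite -messages_cat (messages_perm _ uv) messages_cat vq addnC.
Qed.

Hypothesis hsc : strongly_connected N.

(** Since [P |v| = |v|], an edge from [a] to [d] carries membership in [v] from [a] to [d]. *)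
Lemma cycle_full_support v c : v != [::] -> exec v c c -> forall a, a \in v.
Proof.
case: v => // a v _ vc b.
have [_] := vc; rewrite fire_wordE => cE.
have vq : act_word (a :: v) c.2 = c.2 by rewrite -[in RHS]cE.
have vM e : messages_word (a :: v) c.2 e = count_mem e (a :: v).
  have /(congr1 (fun c' : config N => c'.1 e)) := cE.
  by rewrite ffunE; lia.
have /connectP[p] := hsc a b.
have : a \in a :: v := mem_head a v.
move: (a :: v) vq vM => {v vc cE} v vq vM; elim: p a => [|d p IHp] a av /=.
  by move=> _ ->.
move=> /andP[Pda dp] lastp; apply: IHp dp lastp.
rewrite -has_pred1 has_count -(ltr0n rat) -vM -production_cycle //.
rewrite (bigD1 a) //= ltr_pwDl //.
  by rewrite mulr_gt0 // ltr0n -has_count has_pred1.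
by apply: sumr_ge0 => e _; rewrite mulr_ge0 ?(production_ge0 c.2).
Qed.

(** * Level and drift for a positive left Perron vector *)

Variable s : letter -> algC.
Hypothesis s_gt0 : forall a, 0 < s a.
Hypothesis s_fix : forall a, \sum_b s b * ratr (production b a) = s a.

Definition level c : algC := \sum_a s a * (c.1 a)%:~R.

Definition drift w q : algC :=
  \sum_a s a * ((messages_word w q a)%:R - (count_mem a w)%:R).

Lemma level_fire_word w c : level (fire_word w c) = level c + drift w c.2.
Proof.
rewrite /level /drift -big_split /=; apply: eq_bigr => a _.
by rewrite fire_wordE ffunE -mulrDr -addrA intrD intrB.
Qed.

Lemma drift_cat w u q : drift (w ++ u) q = drift w q + drift u (act_word w q).
Proof.
rewrite /drift -big_split /=; apply: eq_bigr => a _.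
rewrite messages_cat count_cat !natrD; ring.
Qed.

(** The drift of a cycle is [s P |v| - s |v|], and [s P = s]. *)
Lemma drift_cycle v q : act_word v q = q -> drift v q = 0.
Proof.
move=> vq; rewrite /drift; under eq_bigr => a _ do rewrite mulrBr.
rewrite sumrB; apply/eqP; rewrite subr_eq0; apply/eqP.
transitivity (\sum_b \sum_a s b * ratr (production b a) * (count_mem a v)%:R).
  apply: eq_bigr => b _.
  rewrite -[(_ _ b)%:R](ratr_nat algC) -production_cycle //.
  rewrite rmorph_sum mulr_sumr.
  by apply: eq_bigr => a _; rewrite rmorphM /= ratr_nat mulrA.
rewrite exchange_big /=; apply: eq_bigr => a _.
by rewrite -mulr_suml s_fix.
Qed.

(** A word longer than the number of states visits a state twice, and the loop in between has drift
    zero; cutting such loops reduces to words of bounded length. *)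
Lemma drift_bounded : exists B, forall w q, `|drift w q| <= B.
Proof.
pose D := \sum_a \sum_q `|drift [:: a] q|.
have D_ge0 : 0 <= D by apply: sumr_ge0 => a _; apply: sumr_ge0.
have D_ge a q : `|drift [:: a] q| <= D.
  rewrite /D (bigD1 a) //= (bigD1 q) //= -addrA lerDl.
  by rewrite addr_ge0 // sumr_ge0 // => b _; apply: sumr_ge0.
have size_bound w q : `|drift w q| <= D *+ size w.
  elim: w q => [|a w IHw] q.
    rewrite /drift big1 ?normr0 // => a _.
    by rewrite ffunE subrr mulr0.
  rewrite -cat1s drift_cat (le_trans (ler_normD _ _)) // mulrS.
  exact: lerD (D_ge _ _) (IHw _).
exists (D *+ #|gstate N|) => w q.
have [n] := ubnP (size w); elim: n w => // n IHn w w_n.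
have [le_w|gt_w] := leqP (size w) #|gstate N|.
  by rewrite (le_trans (size_bound _ _)) // ler_wpMn2l.
pose F (i : 'I_(size w)) := act_word (take i w) q.
have [|i [j lt_ij Fij]] := ord_pigeonhole F; first by rewrite gt_w.
pose v := drop i (take j w).
have tE : take i w ++ v = take j w.
  by rewrite -[RHS](cat_take_drop i) take_takel // ltnW.
have wE : w = take i w ++ v ++ drop j w by rewrite catA tE cat_take_drop.
have vq : act_word v (act_word (take i w) q) = act_word (take i w) q.
  by rewrite -act_cat tE [RHS]Fij.
have -> : drift w q = drift (take i w ++ drop j w) q.
  by rewrite {1}wE !drift_cat (drift_cycle vq) add0r vq.
apply: IHn; rewrite size_cat size_drop size_takel; last exact: ltnW.
have := ltn_ord j; lia.
Qed.

(** Positivity of [s] bounds each nonnegative coordinate by [B / s a], which leaves finitely many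
    configurations. The length [L] is chosen before the sequence [y]. *)
Lemma bounded_repeat (B : algC) : exists L, forall y : nat -> config N,
    (forall n, (n <= L)%N -> (forall a, 0 <= (y n).1 a) /\ level (y n) <= B) ->
  exists i j, (i < j <= L)%N /\ y i = y j.
Proof.
pose m := (\max_a Num.bound (B / s a))%N.
pose T := ({ffun letter -> 'I_m.+1} * gstate N)%type.
exists #|{: T}| => y yP.
(* [code] forgets signs and values above [m], but it is injective on nonnegative configurations with
   coordinates at most [m]. *)
pose code c : T := ([ffun a => inord `|c.1 a|%N], c.2).
pose F (i : 'I_#|{: T}|.+1) := code (y i).
have [|i [j lt_ij Fij]] := ord_pigeonhole F; first by rewrite ltnSn.
exists i, j; split; first by rewrite lt_ij -ltnS ltn_ord.
have bound (k : 'I_#|{: T}|.+1) a : (`|(y k).1 a| < m.+1)%N.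
  have [y_ge0 yB] := yP k (ltn_ord k).
  rewrite ltnS; apply: leq_trans (leq_bigmax a).
  have ya : s a * ((y k).1 a)%:~R <= B.
    apply: le_trans yB; rewrite /level (bigD1 a) //= lerDl sumr_ge0 // => b _.
    by rewrite mulr_ge0 ?ler0z ?y_ge0 // ltW.
  have B_ge0 : 0 <= B.
    by rewrite (le_trans _ ya) // mulr_ge0 ?ler0z ?y_ge0 // ltW.
  have /archi_boundP := divr_ge0 B_ge0 (ltW (s_gt0 a)).
  rewrite ltr_pdivrMr // [_%:R * _]mulrC.
  move/(le_lt_trans ya); rewrite ltr_pM2l //.
  have -> : ((y k).1 a)%:~R = (`|(y k).1 a|%N)%:R :> algC.
    by rewrite -[in LHS](gez0_abs (y_ge0 a)).
  by rewrite ltr_nat => /ltnW.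
case: Fij => /ffunP yij1 yij2; move: yij1 yij2.
have := yP i (ltn_ord i); have := yP j (ltn_ord j).
have := bound i; have := bound j.
case: (y i) (y j) => [x q] [x' q'] /= bj bi [x'_ge0 _] [x_ge0 _] xx' ->.
congr pair; apply/ffunP => a; have /(congr1 val) := xx' a.
rewrite !ffunE /= !inordK // => eq_abs.
by rewrite -(gez0_abs (x_ge0 a)) eq_abs gez0_abs.
Qed.

End LocalRecurrence.

(** * Recurrent components *)

Section Critical.
Variables (G : digraph) (N : finite_abelian_network G).
Local Notation letter := (letter N).
Implicit Types (b : letter) (w u v : seq letter) (c d : config N).

(* The junk value [0] of [production_matrix] has no eigenvalue of modulus 1. *)
Lemma critical_production :
  critical N -> is_production_matrix (production_matrix N).
Proof.
have [ex _|none] := pselect (exists P, is_production_matrix (N := N) P).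
  exact: xgetPex.
rewrite /critical /production_matrix xgetPN; last first.
  by move=> P; apply: contra_not none; exists P.
set Z := map_mx _ _; have -> : Z = 0.
  by apply/matrixP => i j; rewrite !mxE rmorph0.
move=> [[l /eigenvalueP[v]]].
rewrite mulmx0 => /esym/eqP; rewrite scalemx_eq0 => /orP[/eqP->|/eqP->].
  by rewrite normr0 => _ /esym/eqP; rewrite oner_eq0.
by rewrite eqxx.
Qed.

Lemma Perron_weight : locally_irreducible N -> strongly_connected N ->
    critical N -> gstate N ->
  exists2 s : letter -> algC, (forall a, 0 < s a) &
    forall a, \sum_b s b * ratr (production b a) = s a.
Proof.
move=> hirr hsc hcrit q; pose A : 'M[algC]_#|letter| :=
  map_mx ratr (production_matrix N).
have [||| s s_gt0 sA] := @Perron_vector _ A.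
- move=> i j; rewrite mxE ler0q -[i]enum_valK -[j]enum_valK.
  exact: production_ge0 (critical_production hcrit) _ _ _.
- move=> i j; rewrite -[i]enum_valK -[j]enum_valK.
  have /connectP[p] := hsc (enum_val i) (enum_val j).
  elim: p (enum_val i) => [|c p IHp] a /=.
    by move=> _ ->; exact: connect0.
  move=> /andP[Pca cp] lastp; apply: connect_trans (IHp c cp lastp).
  by apply: connect1; rewrite mxE ltr0q.
- exact: hcrit.
exists (fun a => s 0 (enum_rank a)) => // a.
rewrite -[in RHS]sA mxE [RHS](reindex enum_rank) /=.
  by apply: eq_bigr => b _; rewrite mxE.
exact/onW_bij/enum_rank_bij.
Qed.

Lemma exec_segment (y : nat -> config N) (l : nat -> letter) i n :
    (forall k, (i <= k < i + n)%N -> exec [:: l k] (y k) (y k.+1)) ->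
  exec [seq l k | k <- iota i n] (y i) (y (i + n)%N).
Proof.
elim: n i => [|n IHn] i steps; first by rewrite addn0.
rewrite -addSnnS; apply: (@exec_cat _ _ [:: l i] _ _ (y i.+1)).
  by apply: steps; rewrite leqnn addnS ltnS leq_addr.
apply: IHn => k /andP[ik kn]; apply: steps.
by rewrite (ltnW ik) -addSnnS.
Qed.

Lemma exec_nonneg (y : nat -> config N) (l : nat -> letter) n b :
    (forall k, (k < n)%N -> exec [:: l k] (y k) (y k.+1)) ->
  0 <= (y 0%N).1 b -> 0 <= (y n).1 b.
Proof.
elim: n => // n IHn steps y0.
have yn : 0 <= (y n).1 b by apply: IHn => // k kn; apply: steps; exact: ltnW.
have [/=] := steps n (leqnn _); rewrite andbT => ln <-.
have [eb|nb] := eqVneq b (l n); last exact: le_trans yn (fire_other_ge _ nb).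
rewrite ffunE eb eqxx /=; move: ln; lia.
Qed.

Lemma exec_fired_ge0 b c d : exec [:: b] c d -> 0 <= d.1 b.
Proof. by case=> /=; rewrite andbT => cb <-; rewrite ffunE eqxx /=; lia. Qed.

(** * Nonnegative segments of diverse walks *)

Section Walk.
Variables (I : set int) (x : int -> config N) (l : int -> letter).
Hypothesis walk : infinite_walk I x l.
Hypothesis l_diverse : diverse I l.

Lemma infinite_walk_convex i n k :
  I i -> I (i + n%:Z) -> (k <= n)%N -> I (i + k%:Z).
Proof. by case: walk => -[->|[->|->]] _ //=; lia. Qed.

Lemma infinite_walk_step i n k : I i -> I (i + n%:Z) -> (k < n)%N ->
  exec [:: l (i + k.+1%:Z)] (x (i + k%:Z)) (x (i + k.+1%:Z)).
Proof.
move=> Ii In kn; have [_ step] := walk.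
have -> : i + k%:Z = i + k.+1%:Z - 1 by lia.
apply: step; last exact: infinite_walk_convex In kn.
have -> : i + k.+1%:Z - 1 = i + k%:Z by lia.
exact: infinite_walk_convex In (ltnW kn).
Qed.

Lemma infinite_walk_nonneg i j b :
  I (i - 1) -> I i -> l i = b -> I j -> i <= j -> 0 <= (x j).1 b.
Proof.
move=> Ii1 Ii lib Ij ij; have [_ step] := walk.
have jE : j = i + `|j - i|%N%:Z by lia.
rewrite jE in Ij *.
apply: (@exec_nonneg (fun k => x (i + k%:Z)) (fun k => l (i + k.+1%:Z))).
  by move=> k; apply: infinite_walk_step.
by rewrite addr0; apply: exec_fired_ge0; rewrite -lib; apply: step.
Qed.

(* On a backward walk every letter has fired before time [- L], whence [i]
   depends on [L] and the endpoint is fixed; on the other walks one starts at a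
   fixed time after which every letter has fired. *)
Lemma infinite_walk_nonneg_segment : exists c0, forall L : nat, exists i : int,
  [/\ I i, I (i + L%:Z), forall j b, I j -> i <= j -> 0 <= (x j).1 b &
      c0 = x i \/ c0 = x (i + L%:Z)].
Proof.
case: (walk) => -[IE|IE] _.
  exists (x 0) => L; exists (- L%:Z).
  (* Otherwise every firing of [b] would occur in the finite range from [- L + 1] to [0], against
     diversity. *)
  have before b : exists2 i, I i /\ l i = b & i <= - L%:Z.
    have [] := pselect (exists2 i, I i /\ l i = b & i <= - L%:Z) => // late.
    case: (@l_diverse b).
    apply: (@sub_finite_set _ _ ((fun n : nat => - n%:Z) @` `I_L)).
      move=> i /= [_ [Ii lib]]; exists `|i|%N.
        have [iL|] := lerP i (- L%:Z); first by case: late; exists i.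
        by move: Ii; rewrite IE /=; lia.
      by move: Ii; rewrite IE /=; lia.
    exact/finite_image/finite_II.
  split; try by rewrite IE /=; lia.
    move=> j b Ij ij; have [i [Ii lib] iL] := before b.
    apply: infinite_walk_nonneg lib Ij (le_trans iL ij) => //.
    by move: Ii; rewrite IE /=; lia.
  by right; congr x; lia.
have I_ge0 i : 0 <= i -> I i by case: IE => ->.
have fired b : exists i, I (i - 1) /\ I i /\ l i = b.
  have [] := pselect (exists i, I (i - 1) /\ I i /\ l i = b) => // never.
  case: (@l_diverse b); rewrite (_ : [set i | _]%classic = set0) //.
  by rewrite -subset0 => i ?; case: never; exists i.
pose t b := projT1 (cid (fired b)).
pose i0 := (\max_b `|t b|)%N.
exists (x i0%:Z) => L; exists i0%:Z.
split; [exact: I_ge0 | exact: I_ge0 | | by left].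
move=> j b Ij ij; have : t b <= i0%:Z.
  have : (`|t b| <= i0)%N by apply: leq_bigmax.
  lia.
move: ij; generalize (i0%:Z) => k kj.
rewrite /t; case: cid => i /= [Ii1 [Ii lib]] ik.
exact: infinite_walk_nonneg lib Ij (le_trans ik kj).
Qed.

End Walk.

(** * Legal cycles and recurrent components *)

Lemma periodic_walk v c : v != [::] -> (forall b, b \in v) -> exec v c c ->
  exists (I : set int) (x : int -> config N) (l : int -> letter),
    [/\ infinite_walk I x l, diverse I l & forall i, I i -> reaches c (x i)].
Proof.
move=> v_neq0 v_full [lv vc].
have L_gt0 : (0 < size v)%N by rewrite lt0n size_eq0.
have [a0 _] : exists a, a \in v.
  by case: (v) v_neq0 => // a w _; exists a; exact: mem_head.
pose x (i : int) := fire_word (take (`|i| %% size v) v) c.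
(* The letter at [i] leads from time [i - 1] to time [i], hence the predecessor; its value at [0] is
   junk. *)
pose l (i : int) := nth a0 v (`|i|.-1 %% size v).
exists [set i | 0 <= i]%classic, x, l; split; first split.
- by right; left.
- move=> i /= i1 _; have [n i1E] : exists n : nat, i - 1 = n%:Z.
    by exists `|i - 1|%N; lia.
  have -> : i = n.+1%:Z by lia.
  have -> : n.+1%:Z - 1 = n%:Z :> int by lia.
  rewrite {}/x {}/l !absz_nat /=.
  have r_lt := ltn_pmod n L_gt0; set r := (n %% size v)%N in r_lt *.
  have vE : v = rcons (take r v) (nth a0 v r) ++ drop r.+1 v.
    by rewrite -take_nth // cat_take_drop.
  have lr : 1 <= (fire_word (take r v) c).1 (nth a0 v r).
    by move: lv; rewrite {1}vE cat_rcons legal_cat /= => /andP[_ /andP[]].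
  split; first by rewrite /= lr.
  have -> : fire_word [:: nth a0 v r] (fire_word (take r v) c)
      = fire_word (take r.+1 v) c.
    by rewrite -fire_word_cat cats1 -take_nth.
  have := r_lt; rewrite leq_eqVlt => /orP[/eqP rE|lt_r].
    rewrite rE take_size vc -rE.
    have -> : (n.+1 %% r.+1 = 0)%N; last by rewrite take0.
    by rewrite rE -addn1 -modnDml -/r addn1 rE modnn.
  have -> : (n.+1 %% size v = r.+1)%N; last by [].
  by rewrite -addn1 -modnDml -/r addn1 modn_small.
(* [f n] is the time at which turn [n] fires the first [b] of [v]. *)
- move=> b; pose f n := (n * size v + index b v).+1%:Z.
  have lt_b : (index b v < size v)%N by rewrite index_mem.
  have f_inj : injective f.
    by move=> m n [] /eqP; rewrite eqn_add2r eqn_pmul2r // => /eqP.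
  move=> /(@finite_preimage _ _ _ f (in2W f_inj)).
  apply: (sub_infinite_set _ infinite_nat) => n _ /=.
  split; [by rewrite /f; lia | split => //].
  by rewrite /l /f /= modnMDl modn_small // nth_index.
- move=> i _; exists (take (`|i| %% size v) v); split => //.
  move: lv; rewrite -{1}(cat_take_drop (`|i| %% size v) v) legal_cat.
  by case/andP.
Qed.

(** The endpoint of the given execution [w] is legally related to [c], so recurrence provides a way
    back and closes a cycle. *)
Lemma recurrent_component_of_config (C : set (config N)) :
    locally_irreducible N -> strongly_connected N -> critical N ->
  is_component C -> (exists2 c, C c & recurrent_config c) ->
  recurrent_component C.
Proof.
move=> hirr hsc hcrit [c0 ->] [c c0c [[w [w_neq0 lw]] cP]].
have [|u [lu uc]] := cP (fire_word w c).
  by exists (fire_word w c); split; [exists w | exact: reaches_refl].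
have vc : exec (w ++ u) c c by apply: (@exec_cat _ _ w u c (fire_word w c)).
have v_neq0 : w ++ u != [::] by case: (w) w_neq0.
have v_full :=
  cycle_full_support hirr (critical_production hcrit) hsc v_neq0 vc.
have [I [x [l [walk div Ix]]]] := periodic_walk v_neq0 v_full vc.
exists I, x, l; split => // i /Ix cx /=.
have [d [c0d cd]] := c0c; have [e [de xe]] := confluence cd cx.
by exists e; split => //; exact: reaches_trans de.
Qed.

Lemma recurrent_config_of_component (C : set (config N)) :
    locally_irreducible N -> strongly_connected N -> critical N ->
  recurrent_component C -> exists2 c, C c & recurrent_config c.
Proof.
move=> hirr hsc hcrit [I [x [l [walk div Cx]]]].
have hprod := critical_production hcrit.
have [s s_gt0 s_fix] := Perron_weight hirr hsc hcrit (x 0).2.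
have [B BP] := drift_bounded hirr hprod s_fix.
have [c0 segP] := infinite_walk_nonneg_segment walk div.
(* [c0] is an endpoint of every segment and is fixed before [L], so this level bound is the same for
   all segments. *)
have [L LP] := bounded_repeat s_gt0 (level s c0 + B).
have [i [Ii IL i_nonneg c0E]] := segP L.
pose y n := x (i + n%:Z); pose m k := l (i + k.+1%:Z).
have step k : (k < L)%N -> exec [:: m k] (y k) (y k.+1).
  exact: (infinite_walk_step walk Ii IL).
have seg n k : (n + k <= L)%N ->
    exec [seq m j | j <- iota n k] (y n) (y (n + k)%N).
  move=> nkL; apply: exec_segment => j /andP[_ jn].
  exact/step/(leq_trans jn).
have inI n : (n <= L)%N -> I (i + n%:Z).
  exact: (infinite_walk_convex walk Ii IL).
(* The first inequality serves when [c0] starts the segment, the second when it ends it. In [algC] a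
   bound on the modulus gives order bounds only for real numbers, whence [drift_real]. *)
have level_le c d w : exec w c d -> level s d <= level s c + B /\
    level s c <= level s d + B.
  move=> [_ <-]; rewrite level_fire_word.
  have drift_real : drift s w c.2 \is Num.real.
    apply: rpred_sum => a _; apply: rpredM; first exact/ger0_real/ltW.
    by rewrite rpredB ?realn.
  have /andP[] : - B <= drift s w c.2 <= B by rewrite -real_ler_norml.
  by rewrite -subr_ge0 opprK => lo up; rewrite lerD2l up -addrA lerDl.
have [|j [k [/andP[jk kL] yjk]]] := LP y.
  move=> n nL; split; first by move=> b; apply: i_nonneg; [exact: inI | lia].
  case: c0E => ->.
    have := seg 0%N n nL; rewrite add0n => /level_le[].
    by rewrite /y addr0.
  have := seg n (L - n)%N; rewrite subnKC // leqnn => /(_ isT) /level_le[_].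
  by [].
have jL : (j <= L)%N by rewrite ltnW // (leq_trans jk).
have := seg j (k - j)%N; rewrite subnKC ?(ltnW jk) // kL -yjk => /(_ isT) cyc.
exists (y j); first exact/Cx/inI.
have v_neq0 : [seq m j0 | j0 <- iota j (k - j)] != [::].
  by rewrite -size_eq0 size_map size_iota -lt0n subn_gt0.
have v_full := cycle_full_support hirr hprod hsc v_neq0 cyc.
exact: cycle_recurrent v_neq0 v_full cyc.
Qed.

End Critical.

Local Close Scope ring_scope.

Theorem lemma5p19 (G : digraph) (N : finite_abelian_network G)
    (hirr : locally_irreducible N) (hsc : strongly_connected N)
    (hcrit : critical N) (C : set (config N)) (hC : is_component C) :
  recurrent_component C <-> exists2 c : config N, C c & recurrent_config c.
Proof.
split; first exact: recurrent_config_of_component.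
exact: recurrent_component_of_config.
Qed.
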